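(* Let $S=(X,X_0,f)$ be an incrementally globally asymptotically stable ($\delta$-GAS) transition system, with $X$ a compact subset of $\mathbb{R}^n$ and $X_0\subseteq X$. Let $d$ be a metric on $X$, let $\epsilon:X\times X\to\mathbb{R}_{>0}$ be a resolution function that has global extrema (i.e. attains a global minimum and a global maximum), and let $$\overline{R}=\{(x,\hat x)\in X\times X : d(x,\hat x)\le\epsilon(x,\hat x)\}.$$ Then the set $$\mathcal{W}_S(\overline{R})=\{(\hat S,R) : \hat S \text{ is a deterministic abstraction of } S \text{ and } R \text{ is a multi-resolution approximate bisimulation relation between } S \text{ and } \hat S \text{ with resolution } \overline{R}\}$$ is nonempty.
   Context: Transition system: a tuple $S=(X,X_0,f)$ with $X_0\subseteq X\subset\mathbb{R}^n$ (initial state set and state set) and transition function $f:X\to X$. A behaviour of $S$ from $x_0\in X_0$ is the sequence $x_0x_1x_2\ldots$ with $x_{k+1}=f(x_k)$. $\delta$-GAS: $S$ is $\delta$-GAS if there is a class $\mathcal{KL}$ function $\beta$ such that for all $k\in\mathbb{N}$ and all $x_0,x_0'\in X_0$, $|x_k-x_k'|\le\beta(|x_0-x_0'|,k)$, where $x_0x_1\ldots x_k$ and $x_0'x_1'\ldots x_k'$ are finite behaviours of $S$ and $|\cdot|$ is a norm on $\mathbb{R}^n$. A function $\alpha:\mathbb{R}_{\ge0}\to\mathbb{R}_{\ge0}$ is of class $\mathcal{K}$ if it is continuous, strictly increasing and $\alpha(0)=0$; a function $\beta:\mathbb{R}_{\ge0}\times\mathbb{R}_{\ge0}\to\mathbb{R}_{\ge0}$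 is of class $\mathcal{KL}$ if $\beta(\cdot,t)\in\mathcal{K}$ for each fixed $t\ge0$ and $\beta(s,t)\to0$ as $t\to\infty$ for each fixed $s\ge0$. Quantiser and deterministic abstraction: let $\hat X$ be a collection of finitely many elements of $X$. A quantiser of $X$ is a function $\kappa:X\to\hat X$. The deterministic abstraction of $S$ given by $\kappa$ is the transition system $\hat S=(\hat X,\hat X_0,\hat f)$ with $\hat X_0=\{\hat x\in\hat X:\exists x\in X_0,\ \hat x=\kappa(x)\}$ and $\hat f:\hat X\to\hat X$, $\hat f(\hat x)=\kappa(f(\hat x))$. Multi-resolution approximate bisimulation: $R\subseteq X\times\hat X$ is a multi-resolution approximate bisimulation relation between $S$ and $\hat S$ with resolution $\overline{R}$ if (1) for all $x\in X_0$ there exists $\hat x\in\hat X_0$ with $(x,\hat x)\in R$; (2) for all $(x,\hat x)\in R$, $(f(x),\hat f(\hat x))\in R$; (3) $R\subseteq\overline{R}$; (4) for all $\hat x\in\hat X_0$ there exists $x\in X_0$ with $(x,\hat x)\in R$.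
   Formalization: The δ-GAS bound is assumed for behaviours started at any reachable state, not only at states of X_0, and d(x,·) is assumed continuous on X; without these the claim fails (irrational circle rotation with a single initial state; discrete metric with ε=1/2). *)

(* Defs.v *)
From HB Require Import structures.
From mathcomp Require Import all_boot all_order all_algebra.
From mathcomp Require Import all_classical all_reals all_analysis.

Set Implicit Arguments.
Unset Strict Implicit.
Unset Printing Implicit Defensive.

Import Order.TTheory GRing.Theory Num.Theory.
Import numFieldNormedType.Exports.

Local Open Scope classical_set_scope.
Local Open Scope ring_scope.

(** MathComp-Analysis; R^n is ['rV[R]_n] with its canonical topology.
    A map on a subset A of R^n is a total function of which only the values on
    A matter. *)

Definition is_norm (R : realType) (n : nat) (N : 'rV[R]_n -> R) : Prop :=
  [/\ forall x, 0 <= N x,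
      forall x, N x = 0 -> x = 0,
      forall a x, N (a *: x) = `|a| * N x
    & forall x y, N (x + y) <= N x + N y].

Definition is_metric_on (R : realType) (T : Type) (X : set T)
    (d : T -> T -> R) : Prop :=
  [/\ forall x y, X x -> X y -> 0 <= d x y,
      forall x y, X x -> X y -> (d x y = 0 <-> x = y),
      forall x y, X x -> X y -> d x y = d y x
    & forall x y z, X x -> X y -> X z -> d x z <= d x y + d y z].

Definition class_K (R : realType) (alpha : R -> R) : Prop :=
  [/\ {within [set s : R | 0 <= s], continuous alpha},
      forall s s', 0 <= s -> s < s' -> alpha s < alpha s'
    & alpha 0 = 0].

(** No monotonicity in the second argument is required. *)
Definition class_KL (R : realType) (beta : R -> R -> R) : Prop :=
  (forall t, 0 <= t -> class_K (beta ^~ t)) /\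
  (forall s, 0 <= s -> beta s t @[t --> +oo] --> (0 : R)).

Record system (R : realType) (n : nat) := System {
  state : set 'rV[R]_n;
  init : set 'rV[R]_n;
  trans : 'rV[R]_n -> 'rV[R]_n;
  init_sub : init `<=` state;
  trans_fun : set_fun state state trans }.

Definition behaviour (R : realType) (n : nat) (S : system R n)
    (x : nat -> 'rV[R]_n) : Prop :=
  init S (x 0%N) /\ forall k, x k.+1 = trans S (x k).

Definition delta_GAS (R : realType) (n : nat) (N : 'rV[R]_n -> R)
    (S : system R n) : Prop :=
  exists beta : R -> R -> R, class_KL beta /\
    forall (k : nat) (x x' : nat -> 'rV[R]_n),
      behaviour S x -> behaviour S x' ->
      N (x k - x' k) <= beta (N (x 0%N - x' 0%N)) k%:R.

Definition reachable (R : realType) (n : nat) (S : system R n) :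
    set 'rV[R]_n :=
  [set y | exists x k, behaviour S x /\ y = x k].

Lemma reachable_sub (R : realType) (n : nat) (S : system R n) :
  reachable S `<=` state S.
Proof.
move=> _ [x [k [[x0 xS] ->]]]; elim: k => [|k IH]; first exact: init_sub.
by rewrite xS; apply: trans_fun.
Qed.

(** S restarted from every state occurring on one of its behaviours. Being
    delta-GAS for this system is implied by the usual estimate over all pairs
    of states, and is the same as [delta_GAS N S] when [init S] is forward
    invariant. With [delta_GAS N S] alone, an irrational rotation of the circle
    with a single initial state would qualify vacuously, though no finite
    deterministic system tracks it. *)
Definition restarted (R : realType) (n : nat) (S : system R n) : system R n :=
  System (@reachable_sub R n S) (@trans_fun R n S).

Definition quantiser (R : realType) (n : nat) (X Xh : set 'rV[R]_n)
    (kappa : 'rV[R]_n -> 'rV[R]_n) : Prop :=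
  [/\ finite_set Xh, Xh `<=` X & set_fun X Xh kappa].

Definition is_abstraction_by (R : realType) (n : nat) (S Sh : system R n)
    (kappa : 'rV[R]_n -> 'rV[R]_n) : Prop :=
  [/\ quantiser (state S) (state Sh) kappa,
      init Sh = [set xh | state Sh xh /\ exists2 x, init S x & xh = kappa x]
    & forall xh, state Sh xh -> trans Sh xh = kappa (trans S xh)].

Definition deterministic_abstraction (R : realType) (n : nat)
    (S Sh : system R n) : Prop :=
  exists kappa, is_abstraction_by S Sh kappa.

Definition approx_bisimulation (R : realType) (n : nat) (S Sh : system R n)
    (Rbar rel : set ('rV[R]_n * 'rV[R]_n)) : Prop :=
  rel `<=` state S `*` state Sh /\
  [/\ forall x, init S x -> exists2 xh, init Sh xh & rel (x, xh),
      forall x xh, rel (x, xh) -> rel (trans S x, trans Sh xh),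
      rel `<=` Rbar
    & forall xh, init Sh xh -> exists2 x, init S x & rel (x, xh)].

Definition resolution_set (R : realType) (n : nat) (X : set 'rV[R]_n)
    (d eps : 'rV[R]_n -> 'rV[R]_n -> R) : set ('rV[R]_n * 'rV[R]_n) :=
  [set p | [/\ X p.1, X p.2 & d p.1 p.2 <= eps p.1 p.2]].

Definition has_global_extrema (R : realType) (T : Type) (X : set T)
    (eps : T -> T -> R) : Prop :=
  (exists a b, [/\ X a, X b & forall x y, X x -> X y -> eps a b <= eps x y]) /\
  (exists a b, [/\ X a, X b & forall x y, X x -> X y -> eps x y <= eps a b]).

Definition W (R : realType) (n : nat) (S : system R n)
    (Rbar : set ('rV[R]_n * 'rV[R]_n)) :
    set (system R n * set ('rV[R]_n * 'rV[R]_n)) :=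
  [set p | deterministic_abstraction S p.1 /\
           approx_bisimulation S p.1 Rbar p.2].

(* Main.v *)
(** With [e] the minimum of [eps], it suffices to track within [d]-distance [e].
    Incremental stability contracts all reachable states uniformly, so for some
    [K] the forward invariant set [P] of their [K]-th iterates has [d]-diameter
    at most [e]. Two initial states whose first [K + 1] positions fall in the
    same cells of a finite partition of the state set into cells of diameter at
    most [e] thus stay [e]-close forever. The abstraction therefore only needs
    the first [K + 1] positions of one representative per such itinerary, and
    one point of [P]. *)
Require Import Defs.
From HB Require Import structures.
From mathcomp Require Import all_boot all_order all_algebra.
From mathcomp Require Import all_classical all_reals all_analysis.
From mathcomp Require Import finmap.

Set Implicit Arguments.
Unset Strict Implicit.
Unset Printing Implicit Defensive.

Import Order.TTheory GRing.Theory Num.Theory.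
Import numFieldNormedType.Exports.
Local Open Scope classical_set_scope.
Local Open Scope ring_scope.

(** Expanding [x] in the standard basis bounds [N x] by the sum of the norms of the basis vectors
    times the maximum norm. Adding 1 keeps the constant positive when [n] is 0. *)
Lemma is_norm_le_mx_norm (R : realType) (n : nat) (N : 'rV[R]_n -> R) :
  is_norm N -> exists2 C : R, 0 < C & forall x, N x <= C * `|x|.
Proof.
move=> [N0 _ NZ ND].
have NO : N 0 = 0 by rewrite -(scale0r 0) NZ normr0 mul0r.
pose C := \sum_j N (delta_mx 0 j).
have C0 : 0 <= C by apply: sumr_ge0 => j _; exact: N0.
exists (C + 1) => [|x]; first by rewrite ltr_wpDl.
apply: (@le_trans _ _ (C * `|x|)); last by rewrite ler_wpM2r// lerDl.
rewrite {1}(row_sum_delta x) /C mulr_suml.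
apply: (big_rec2 (fun u v => N u <= v)); first by rewrite NO.
move=> j u v _ uv; apply: le_trans (ND _ _) _; apply: lerD => //.
rewrite NZ mulrC ler_wpM2l//.
rewrite [leRHS]/Num.norm/= mx_normrE.
by apply/bigmax_geP; right => /=; exists (0, j).
Qed.

(** By the triangle inequality, [N] drops by at most [C] times the distance moved. *)
Lemma is_norm_lt_near (R : realType) (n : nat) (N : 'rV[R]_n -> R)
    (v : 'rV[R]_n) (r : R) :
  is_norm N -> r < N v -> \forall u \near v, r < N u.
Proof.
move=> hN rv; have [C C0 NC] := is_norm_le_mx_norm hN.
have [_ _ _ ND] := hN.
have e0 : 0 < (N v - r) / C by rewrite divr_gt0// subr_gt0.
have := nbhsx_ballx v _ e0; rewrite mx_norm_ball; apply: filterS => u /= vu.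
have := ND (v - u) u; rewrite subrK => h.
have := NC (v - u); move: vu.
rewrite ltr_pdivlMr// mulrC => vu /le_lt_trans/(_ vu).
by rewrite ltrBrDl -ltrBrDr => /lt_le_trans; apply; rewrite lerBlDl.
Qed.

Lemma metric_near (R : realType) (n : nat) (X : set 'rV[R]_n)
    (d : 'rV[R]_n -> 'rV[R]_n -> R) (e : R) (x : 'rV[R]_n) :
  is_metric_on X d -> (forall x, X x -> {within X, continuous (d x)}) ->
  0 < e -> X x -> \forall y \near x, X y -> d x y < e.
Proof.
move=> [_ d0 _ _] dc e0 Xx.
have /subspace_continuousP/(_ x Xx) dxc := dc _ Xx.
have dxx : d x x < e by rewrite (d0 x x Xx Xx).2.
by have := cvgr_lt _ dxc _ dxx; rewrite near_withinE; apply; exact: within_filter.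
Qed.

(** Compactness of the square of [X] makes a local statement uniform. Near a diagonal point both
    arguments are within [e / 2] of it in [d]; near any other point [N (x - y)] stays away from 0,
    so for small [r] there is nothing to prove. *)
Lemma metric_uniformly_small (R : realType) (n : nat) (N : 'rV[R]_n -> R)
    (X : set 'rV[R]_n) (d : 'rV[R]_n -> 'rV[R]_n -> R) (e : R) :
  is_norm N -> compact X -> is_metric_on X d ->
  (forall x, X x -> {within X, continuous (d x)}) -> 0 < e ->
  exists2 r, 0 < r & forall x y, X x -> X y -> N (x - y) < r -> d x y <= e.
Proof.
move=> hN cX hd dc e0.
have /compact_near_coveringP cXX := compact_setX cX cX.
have := cXX _ 0^'+ (fun r p =>
  X p.1 -> X p.2 -> N (p.1 - p.2) < r -> d p.1 p.2 <= e) _.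
case.
  move=> [x y] [/= Xx Xy].
  have [<-{Xy y}|xy] := eqVneq x y.
    have dx : \forall z \near x, X z -> d x z < e / 2.
      by apply: metric_near => //; rewrite divr_gt0.
    pose U := [set z | X z -> d x z < e / 2].
    exists (U `*` U, setT); first by split; [exists (U, U)|exact: filterT].
    move=> [[u v] r] [/= [du dv] _] Xu Xv _.
    have [_ _ ds dt] := hd.
    apply: le_trans (dt u x v Xu Xx Xv) _; rewrite (ds u x)// (splitr e).
    by apply: lerD; apply: ltW; [exact: du|exact: dv].
  have Nxy : 0 < N (x - y).
    have [N0 N1 _ _] := hN; rewrite lt_neqAle N0 andbT eq_sym.
    by apply: contra xy => /eqP/N1/eqP; rewrite subr_eq0.
  have sub2 : (fun p : 'rV[R]_n * 'rV[R]_n => p.1 - p.2) @ (x, y) --> x - y.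
    by apply: cvgB; [exact: cvg_fst|exact: cvg_snd].
  have Nbig : \forall p \near (x, y), N (x - y) / 2 < N (p.1 - p.2).
    apply: (sub2 _ (is_norm_lt_near hN _)).
    by rewrite ltr_pdivrMr// mulr_natr mulr2n ltrDl.
  exists ([set p | N (x - y) / 2 < N (p.1 - p.2)], [set r | r < N (x - y) / 2]).
    by split => //=; apply: nbhs_right_lt; rewrite divr_gt0.
  move=> [[u v] r] [/= /ltW h1 h2] _ _ /lt_trans/(_ h2).
  by rewrite ltNge h1.
move=> r /= r0 h.
exists (r / 2); first by rewrite divr_gt0.
have r2 : 0 < r / 2 by rewrite divr_gt0.
move=> x y Xx Xy; apply: (h (r / 2) _ r2 (x, y)) => //=.
by rewrite sub0r normrN gtr0_norm// ltr_pdivrMr// mulr_natr mulr2n ltrDl.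
Qed.

Lemma finite_coloring (R : realType) (n : nat) (X : set 'rV[R]_n)
    (d : 'rV[R]_n -> 'rV[R]_n -> R) (e : R) :
  compact X -> is_metric_on X d ->
  (forall x, X x -> {within X, continuous (d x)}) -> 0 < e ->
  exists (C : finType) (c : 'rV[R]_n -> C),
    forall x y, X x -> X y -> c x = c y -> d x y <= e.
Proof.
move=> cX hd dc e0.
(* Points outside [X] are let in so that, for [x] in [X], [B x] is a neighbourhood of [x] in the
   whole space. *)
pose B x : set 'rV[R]_n := [set y | X y -> d x y < e / 2].
have e2 : 0 < e / 2 by rewrite divr_gt0.
have : cover_compact X by rewrite -compact_cover.
move=> /(_ _ X (fun x => (B x)^°)).
case; first by move=> x _; exact: open_interior.
  by move=> x Xx; exists x => //; exact: metric_near.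
move=> D DX Xcov.
(* The colour is the index of one chosen [B i] containing [x]; on [X] it is never [None]. *)
pose c x : option D := [pick i : D | `[< B (fsval i) x >]].
exists (option D : finType), c => x y Xx Xy.
have Bc z : X z -> exists2 i : D, c z = Some i & B (fsval i) z.
  move=> Xz; rewrite /c; case: pickP => [i /asboolP Bi|no]; first by exists i.
  have [i /= iD /interior_subset Bi] := Xcov z Xz.
  by have := no [` iD]%fset; rewrite asboolT.
have [i cx Bix] := Bc x Xx; have [j cy Bjy] := Bc y Xy.
rewrite cx cy => -[ij]; subst j.
have Xi : X (fsval i) by apply: set_mem; apply: DX; exact: fsvalP.
have [_ _ ds dt] := hd.
apply: le_trans (dt _ _ _ Xx Xi Xy) _; rewrite ds// (splitr e).
by apply: lerD; apply: ltW; [exact: Bix|exact: Bjy].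
Qed.

(** Treated apart because without initial states nothing is reachable and the absorbing set is
    empty. A one-point system with the empty relation then works vacuously. *)
Lemma W_init0 (R : realType) (n : nat) (S : system R n)
    (Rbar : set ('rV[R]_n * 'rV[R]_n)) :
  state S !=set0 -> init S = set0 -> W S Rbar !=set0.
Proof.
move=> [a Xa] i0.
have fS : set_fun [set a] [set a] (fun=> a) by move=> x.
exists (System (@sub0set _ [set a]) fS, set0); split => /=; last first.
  by split=> //; split=> // x; rewrite i0.
exists (fun=> a); split => //=.
  by split => // x ->.
by rewrite i0; apply/esym/seteqP; split => // x [_ []].
Qed.

(** The metric enters only through the last two hypotheses; the rest is combinatorics of
    itineraries. *)
Lemma W_nonempty_absorbing (R : realType) (n : nat) (S : system R n)
    (Rbar : set ('rV[R]_n * 'rV[R]_n)) (P : set 'rV[R]_n) (K : nat)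
    (C : finType) (c : 'rV[R]_n -> C) :
  P !=set0 -> P `<=` state S -> set_fun P P (trans S) ->
  (forall x, init S x -> P (iter K (trans S) x)) ->
  (forall x y, P x -> P y -> Rbar (x, y)) ->
  (forall x y, state S x -> state S y -> c x = c y -> Rbar (x, y)) ->
  W S Rbar !=set0.
Proof.
set f := trans S; set X := state S; move=> [q Pq] PX fP fKP RP Rc.
have fX k x : X x -> X (iter k f x).
  by move=> Xx; elim: k => //= k; exact: trans_fun.
have fPk k x : P x -> P (iter k f x).
  by move=> Px; elim: k => //= k; exact: fP.
pose sig x := [ffun k : 'I_K.+1 => c (iter k f x)].
(* An itinerary that no initial state has gets the default [q], whose orbit stays in [P], so that
   [gX] and [gK] hold for every [s]. *)
pose g s := xget q [set x | init S x /\ sig x = s].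
have gP s : init S (g s) \/ g s = q.
  by rewrite /g; case: xgetP => [y _ []|_]; [left|right].
have gsig x : init S x -> init S (g (sig x)) /\ sig (g (sig x)) = sig x.
  by move=> ix; rewrite /g; case: xgetP => [y _ []//|/(_ x)[]].
have gX s : X (g s) by case: (gP s) => [/init_sub//|->]; exact: PX.
have gK s : P (iter K f (g s)) by case: (gP s) => [/fKP//|->]; exact: fPk.
pose h (p : 'I_K.+1 * {ffun 'I_K.+1 -> C}) := iter p.1 f (g p.2).
pose Xh := q |` range h.
have hXh k s : (k <= K)%N -> Xh (iter k f (g s)).
  by move=> kK; right; exists (inord k, s) => //; rewrite /h /= inordK.
have XhX : Xh `<=` X.
  by move=> _ [->|[p _ <-]]; [exact: PX|exact: fX].
(* A step can leave the grid only from [q] or from time [K], and then it lands in [P]. *)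
have fXh y : Xh y -> Xh (f y) \/ P (f y).
  move=> [->|[[k s] _ <-]]; first by right; exact: fP.
  have := ltn_ord k; rewrite ltnS leq_eqVlt => /orP[/eqP kK|kK].
    by right; rewrite /h /= kK; exact: fP.
  by left; rewrite /h /= -iterS; exact: hXh.
(* Grid points are fixed, so representatives are followed exactly up to time
   [K]; [P] is mapped into itself, so errors made later are harmless. *)
pose kap y := if `[< Xh y >] then y else if `[< P y >] then q else g (sig y).
have kapXh y : Xh (kap y).
  rewrite /kap; case: asboolP => // _; case: asboolP => _; first by left.
  exact: (hXh 0%N).
have kap_id y : Xh y -> kap y = y by move=> Xy; rewrite /kap asboolT.
have kapP y : P y -> P (kap y).
  by move=> Py; rewrite /kap; case: asboolP => // _; rewrite asboolT.
pose init' := [set xh | Xh xh /\ exists2 x, init S x & xh = kap x].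
have i'Xh : init' `<=` Xh by move=> y [].
have f'Xh : set_fun Xh Xh (kap \o f) by move=> y _; exact: kapXh.
(* [x] is shadowed by its representative, or both are absorbed in [P], or [x]
   is a grid point not yet re-quantised. *)
pose rel := [set p : 'rV[R]_n * 'rV[R]_n | [/\ X p.1, Xh p.2 &
  [\/ exists k x, [/\ (k <= K)%N, init S x, p.1 = iter k f x &
                     p.2 = iter k f (g (sig x))],
     P p.1 /\ P p.2 | p.1 = p.2]]].
have rel0 x : init S x -> rel (x, kap x).
  move=> ix; have Xx := init_sub ix; split => //=.
  have [Xhx|nXhx] := pselect (Xh x); first by apply: Or33; rewrite kap_id.
  have [Px|nPx] := pselect (P x); first by apply: Or32; split => //; exact: kapP.
  by apply: Or31; exists 0%N, x; split => //=; rewrite /kap !asboolF.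
exists (System i'Xh f'Xh, rel); split => /=.
  exists kap; split => //=; split => //.
  rewrite finite_setU; split; first exact: finite_set1.
  exact: finite_image.
split => /=; first by move=> [x y] [].
split => /=.
- by move=> x ix; exists (kap x); [split => //; exists x|exact: rel0].
- move=> x xh [/= Xx Xhxh H]; split => /=; [exact: trans_fun|exact: kapXh|].
  case: H => [[k [x0 [kK ix0 -> ->]]]|[Px Pxh]|xxh].
  (* From [k = K] both successors lie in [P]; before that, the representative moves to a grid point,
     which [kap] fixes. *)
  + move: kK; rewrite leq_eqVlt => /orP[/eqP ->|kK].
      apply: Or32; split; first by apply: fP; exact: fKP.
      by apply: kapP; exact: fP.
    by apply: Or31; exists k.+1, x0; split => //; rewrite kap_id//; exact: (hXh k.+1).
  + by apply: Or32; split; [exact: fP|apply: kapP; exact: fP].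
  + subst xh; have [/kap_id fx|Pfx] := fXh x Xhxh; first exact: Or33.
    by apply: Or32; split; [|exact: kapP].
- move=> [x xh] [/= Xx Xhxh]; case => [[k [x0 [kK ix0 xE xhE]]]|[Px Pxh]|<-].
  + apply: Rc => //; first exact: XhX.
    (* [x0] and its representative have the same itinerary, hence the same colour at time [k]. *)
    have [_ /ffunP/(_ (inord k))] := gsig _ ix0.
    by rewrite !ffunE inordK// xE xhE.
  + exact: RP.
  + exact: Rc.
- by move=> xh [_ [x ix ->]]; exists x => //; exact: rel0.
Qed.

Lemma iter_reachable (R : realType) (n : nat) (S : system R n) k x :
  reachable S x -> reachable S (iter k (trans S) x).
Proof.
move=> [u [j [[u0 uS] ->]]]; exists u, (k + j)%N; split => //.
by elim: k => //= k ->; rewrite addSn uS.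
Qed.

Lemma behaviour_iter (R : realType) (n : nat) (S : system R n) x :
  init S x -> behaviour S (fun k => iter k (trans S) x).
Proof. by move=> ix; split. Qed.

(** Compactness bounds all starting distances by one [D], and [beta] increases in its first
    argument, so a time [K] with [beta D K < r] serves every pair. Restarting makes all reachable
    states initial. *)
Lemma reachable_uniform_contraction (R : realType) (n : nat)
    (N : 'rV[R]_n -> R) (S : system R n) (r : R) :
  is_norm N -> compact (state S) -> delta_GAS N (restarted S) -> 0 < r ->
  exists K, forall x y, reachable S x -> reachable S y ->
    N (iter K (trans S) x - iter K (trans S) y) < r.
Proof.
move=> hN cX [beta [[bK b0] hb]] r0.
have [C C0 NC] := is_norm_le_mx_norm hN.
have [M [_ XM]] := compact_bounded cX.
pose B := M + 1; have XB x : state S x -> `|x| <= B.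
  by apply: XM; rewrite ltrDl.
(* The absolute value gives [0 <= D] even when the state set is empty and [M] may be negative. *)
pose D : R := `|C * (B + B)|.
have /b0/cvgr_lt/(_ r r0) : 0 <= D by exact: normr_ge0.
move=> [T [_ bT]].
pose K := (Num.truncn `|T|).+1; exists K => x y Rx Ry.
have := hb K _ _ (@behaviour_iter R n (restarted S) x Rx)
                 (@behaviour_iter R n (restarted S) y Ry).
move=> /le_lt_trans; apply => /=.
have TK : T < K%:R by apply: le_lt_trans (ler_norm T) _; exact: truncnS_gt.
apply: le_lt_trans _ (bT _ TK).
have K0 : 0 <= K%:R :> R by [].
have [_ binc _] := bK _ K0.
have : N (x - y) <= D.
  apply: le_trans (NC _) (le_trans _ (ler_norm _)).
  rewrite ler_wpM2l ?(ltW C0)//; apply: le_trans (ler_normB _ _) _.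
  by apply: lerD; apply: XB; exact: reachable_sub.
rewrite le_eqVlt => /orP[/eqP ->//|ND]; apply/ltW/binc => //.
by have [] := hN.
Qed.

Theorem corollary1 (R : realType) (n : nat) (N : 'rV[R]_n -> R)
    (S : system R n) (d eps : 'rV[R]_n -> 'rV[R]_n -> R)
    (hN : is_norm N)
    (hX : compact (state S))
    (hS : delta_GAS N (restarted S))
    (hd : is_metric_on (state S) d)
    (* the metric d is compatible with the topology of the state set *)
    (hdc : forall x, state S x -> {within state S, continuous (d x)})
    (heps : forall x y, state S x -> state S y -> 0 < eps x y)
    (hext : has_global_extrema (state S) eps) :
  W S (resolution_set (state S) d eps) !=set0.
Proof.
have [[a [b [Xa Xb hmin]]] _] := hext.
have e0 := heps _ _ Xa Xb; set e := eps a b in e0 hmin.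
have [i0|/set0P[x0 ix0]] := eqVneq (init S) set0.
  by apply: W_init0 => //; exists a.
have [r r0 Nd] := metric_uniformly_small hN hX hd hdc e0.
have [K hK] := reachable_uniform_contraction hN hX hS r0.
have [C [c hc]] := finite_coloring hX hd hdc e0.
have initR x : init S x -> reachable S x.
  by move=> ix; exists (fun k => iter k (trans S) x), 0%N.
pose P := iter K (trans S) @` reachable S.
have PX : P `<=` state S.
  by move=> _ [x Rx <-]; apply: reachable_sub; exact: iter_reachable.
apply: (@W_nonempty_absorbing _ _ _ _ P K C c) => //.
- by exists (iter K (trans S) x0), x0 => //; exact: initR.
(* [trans S] commutes with its iterates, so it maps [P] into itself. *)
- move=> _ [x Rx <-]; exists (trans S x); first exact: (@iter_reachable _ _ _ 1).
  by rewrite -iterSr.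
- by move=> x ix; exists x => //; exact: initR.
- move=> x y Px Py; split; [exact: PX|exact: PX|].
  apply: le_trans _ (hmin _ _ (PX _ Px) (PX _ Py)).
  apply: Nd; [exact: PX|exact: PX|].
  by move: Px Py => [u Ru <-] [v Rv <-]; exact: hK.
- by move=> x y Xx Xy cxy; split => //; apply: le_trans _ (hmin _ _ Xx Xy); exact: hc.
Qed.
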